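(* Let $n\ge 2$. Every lattice $\Gamma$ of the Lie group $F_n$ is isomorphic to a group $\Gamma_{g(1)}$, the semidirect product of the normal abelian group $L=\ker(p\circ j)$ by the group $\mathbb{Z}$, where $j:\Gamma\to F_n$ is the inclusion and $p:F_n\to F_n/H_n$ is the canonical projection, via the action of $\mathbb{Z}$ on $L$ given (for the generator $1\in\mathbb{Z}$) by a unipotent matrix $$g(1)=I_n+\sum_{k>l}a_{kl}E_{k,l}$$ in an ordered basis $(e_1,e_2,\dots,e_n)$ of $L$.
   Context: For $n\ge 2$, $\mathcal{L}_n(\mathbb{R})$ is the real Lie algebra with basis $x_0,x_1,\dots,x_n$ whose only nonzero brackets (up to antisymmetry) are $[x_0,x_i]=x_{i+1}$ for $1\le i\le n-1$, and $F_n$ is the simply connected real Lie group with Lie algebra $\mathcal{L}_n(\mathbb{R})$. $H_n$ denotes the maximal abelian normal subgroup (of codimension 1) of $F_n$, namely the connected subgroup with Lie algebra $\mathrm{Span}\{x_1,\dots,x_n\}$; one has $F_n/H_n\cong\mathbb{R}$. A lattice of $F_n$ is a discrete cocompact subgroup. Thus $L=\Gamma\cap H_n$, a lattice of $H_n\cong\mathbb{R}^n$, and ''basis of $L$'' means $\mathbb{Z}$-basis. $E_{k,l}$ is the $n\times n$ matrix with a single nonzero entry, equal to $1$, in row $k$ and column $l$.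
   Formalization: For n = 2 the claim with H_2 fixed fails (the lattice generated by exp(x_0) and exp(√2 x_0 + x_1) meets H_2 only in its centre), so for n = 2 H_2 is replaced by some maximal abelian normal subgroup of F_2 depending on Γ; for n ≥ 3 it is H_n as stated. *)

(* Defs.v *)
From HB Require Import structures.
From mathcomp Require Import all_boot all_order all_algebra.
From mathcomp Require Import generic_quotient.
From mathcomp Require Import all_classical all_reals all_analysis.
From mathcomp Require Import ring.

Set Implicit Arguments.
Unset Strict Implicit.
Unset Printing Implicit Defensive.

Import Order.TTheory GRing.Theory Num.Theory.
Import numFieldNormedType.Exports.

Local Open Scope classical_set_scope.
Local Open Scope ring_scope.
Local Open Scope quotient_scope.

Section Subgroup.
Variables (G : groupType) (H : groupClosed G).

Definition subgroup : Type := {x : G | x \in H}.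

HB.instance Definition _ := SubChoice.on subgroup.

Fact subgroup_closed : group_closed (fun x : G => x \in H).
Proof. by split=> [|x y]; [exact: gpred1 | exact: gpredF]. Qed.

HB.instance Definition _ :=
  SubChoice_isSubGroup.Build G (fun x : G => x \in H) subgroup subgroup_closed.

Definition coset_rel : rel G := fun x y => (x^-1 * y)%g \in H.

Fact coset_rel_equiv : equiv_class_of coset_rel.
Proof.
split; rewrite /coset_rel.
- by move=> x; rewrite mulVg gpred1.
- by move=> x y; rewrite -(gpredV H) invgM invgK.
- move=> y x z xy yz.
  by rewrite -(mulgK y (x^-1)%g) -mulgA gpredM.
Qed.

Canonical coset_equiv := EquivRelPack coset_rel_equiv.

(* The space G / H of left cosets x H. *)
Definition cosets : Type := {eq_quot coset_equiv}.
HB.instance Definition _ := Quotient.on cosets.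

Lemma cosetsP (x y : G) :
  (\pi_cosets x = \pi_cosets y) <-> (x^-1 * y)%g \in H.
Proof. by split=> [/eqmodP|h]; last apply/eqmodP. Qed.

End Subgroup.

Section Kernel.
Variables (G : groupType) (H K : groupClosed G).

Definition incl : subgroup K -> G := val.
Definition proj : G -> cosets H := \pi.

Definition ker_proj_incl : {pred subgroup K} :=
  fun x => (proj \o incl) x == proj 1%g.

Fact ker_proj_inclE x : (x \in ker_proj_incl) = (val x \in H).
Proof.
rewrite unfold_in /= -[RHS](gpredV H) -[_^-1%g]mulg1.
by apply/eqP/idP => /cosetsP.
Qed.

Fact ker_proj_incl_mul : mulg_closed ker_proj_incl.
Proof. by move=> x y; rewrite !ker_proj_inclE valM; apply: gpredM. Qed.
Fact ker_proj_incl_1 : 1%g \in ker_proj_incl.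
Proof. exact: eqxx. Qed.
Fact ker_proj_incl_inv : invg_closed ker_proj_incl.
Proof.
move=> x; rewrite !ker_proj_inclE => Hx.
suff -> : val (x^-1)%g = ((val x)^-1)%g by rewrite gpredV.
by apply: (mulIg (val x)); rewrite -valM !mulVg.
Qed.

HB.instance Definition _ :=
  isMulClosed.Build (subgroup K) ker_proj_incl ker_proj_incl_mul.
HB.instance Definition _ :=
  isMul1Closed.Build (subgroup K) ker_proj_incl ker_proj_incl_1.
HB.instance Definition _ :=
  isInvClosed.Build (subgroup K) ker_proj_incl ker_proj_incl_inv.

End Kernel.
Arguments ker_proj_incl {G} H K _.

Section AbelianNormal.
Variable G : groupType.
Implicit Types H K : groupClosed G.

Definition abelian_normal H : Prop :=
  {in H &, forall x y, commute x y} /\ forall x y, x \in H -> (x ^ y)%g \in H.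

Definition maximal_abelian_normal H : Prop :=
  abelian_normal H /\
  forall K, abelian_normal K -> {subset H <= K} -> {subset K <= H}.

End AbelianNormal.

Section LieAlgebra.
Variables (R : realType) (n : nat).

(* A pair (a, v) stands for a x_0 + v_1 x_1 + ... + v_n x_n, and ad_x0 is the
   matrix of [x_0, -] on Span{x_1, ..., x_n}. *)
Definition ad_x0 : 'M[R]_n := \matrix_(i, j) (i == j.+1 :> nat)%:R.

Definition filiform_lie : Type := (R * 'cV[R]_n)%type.
HB.instance Definition _ := GRing.Lmodule.copy filiform_lie (R^o * 'cV[R]_n)%type.

Definition bracket (X Y : filiform_lie) : filiform_lie :=
  (0, X.1 *: (ad_x0 *m Y.2) - Y.1 *: (ad_x0 *m X.2)).

(* x_ i is 0 for i > n. *)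
Definition x_ (i : nat) : filiform_lie :=
  if i is j.+1 then (0, \col_k (k == j :> nat)%:R) else (1, 0).

Lemma bracket_x0 i : bracket (x_ 0) (x_ i.+1) = x_ i.+2.
Proof.
rewrite /bracket /= scale1r scale0r subr0; congr pair.
apply/colP => k; rewrite !mxE.
under eq_bigr do rewrite !mxE.
case: (ltnP i n) => [lt_in|le_ni].
  rewrite (bigD1 (Ordinal lt_in)) //= eqxx mulr1 big1 ?addr0 // => j.
  by rewrite -val_eqE /= => /negbTE ->; rewrite mulr0.
rewrite big1 => [|j _]; last first.
  by rewrite [j == i :> nat](ltn_eqF (leq_trans (ltn_ord j) le_ni)) mulr0.
by rewrite (ltn_eqF (leq_trans (ltn_ord k) (leqW le_ni))).
Qed.

Lemma bracket_xx i j : bracket (x_ i.+1) (x_ j.+1) = 0.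
Proof. by rewrite /bracket /= !scale0r subr0. Qed.

Lemma bracket_anti X Y : bracket X Y = - bracket Y X.
Proof.
by rewrite /bracket; congr pair => /=; rewrite ?oppr0 // opprB.
Qed.

Fact ad_x0_exp k i j : (ad_x0 ^+ k) i j = (i == (j + k)%N :> nat)%:R.
Proof.
elim: k i j => [|k IH] i j; first by rewrite expr0 mxE addn0 val_eqE.
rewrite exprS mxE; under eq_bigr do rewrite IH mxE.
case: (ltnP (j + k) n) => [lt_jkn|le_njk].
  rewrite (bigD1 (Ordinal lt_jkn)) //= eqxx mulr1 big1 ?addr0 ?addnS // => l.
  by rewrite -val_eqE /= => /negbTE ->; rewrite mulr0.
rewrite big1 => [|l _]; last first.
  by rewrite [l == _ :> nat](ltn_eqF (leq_trans (ltn_ord l) le_njk)) mulr0.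
by rewrite addnS (ltn_eqF (leq_trans (ltn_ord i) (leqW le_njk))).
Qed.

Fact ad_x0_nilp k : (n <= k)%N -> ad_x0 ^+ k = 0.
Proof.
move=> le_nk; apply/matrixP => i j; rewrite ad_x0_exp mxE.
by rewrite (ltn_eqF (leq_trans (leq_trans (ltn_ord i) le_nk) (leq_addl _ _))).
Qed.

(* The full exponential series, since ad_x0 ^+ n = 0. *)
Definition exp_ad_x0 (t : R) : 'M[R]_n :=
  \sum_(k < n) (t ^+ k / k`!%:R) *: ad_x0 ^+ k.

Fact exp_ad_x0_0 : exp_ad_x0 0 = 1%:M.
Proof.
apply/matrixP => i j; rewrite /exp_ad_x0 summxE.
have n0 : (0 < n)%N by case: (n) i => [[]|].
rewrite (bigD1 (Ordinal n0)) //= big1 => [|k].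
  by rewrite addr0 !expr0 divr1 scale1r.
rewrite -val_eqE /= => k0; rewrite expr0n (negbTE k0) mul0r scale0r.
by rewrite mxE.
Qed.

Fact exp_ad_x0_D s t : exp_ad_x0 (s + t) = exp_ad_x0 s *m exp_ad_x0 t.
Proof.
pose F i j : 'M[R]_n :=
  ((s ^+ i / i`!%:R) * (t ^+ j / j`!%:R)) *: ad_x0 ^+ (i + j).
have -> : exp_ad_x0 s *m exp_ad_x0 t = \sum_(i < n) \sum_(j < n) F i j.
  rewrite [LHS]mulr_suml; apply: eq_bigr => i _.
  rewrite mulr_sumr; apply: eq_bigr => j _.
  by rewrite -[LHS]/(_ *m _) -scalemxAl -scalemxAr scalerA /F exprD.
have -> : exp_ad_x0 (s + t) = \sum_(k < n) \sum_(i < k.+1) F i (k - i)%N.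
  apply: eq_bigr => k _; rewrite addrC exprDn mulr_suml scaler_suml.
  apply: eq_bigr => i _; rewrite /F subnKC; last by rewrite -ltnS ltn_ord.
  congr (_ *: _); rewrite -(bin_fact (ltn_ord i : (i <= k)%N)) !natrM -mulr_natr.
  have : 'C(k, i)%:R != 0 :> R by rewrite pnatr_eq0 -lt0n bin_gt0 -ltnS.
  have : i`!%:R != 0 :> R by rewrite pnatr_eq0 -lt0n fact_gt0.
  have : (k - i)`!%:R != 0 :> R by rewrite pnatr_eq0 -lt0n fact_gt0.
  move: ('C(k, i)%:R : R) (i`!%:R : R) ((k - i)`!%:R : R) => c p q q0 p0 c0.
  by field; rewrite q0 p0 c0.
transitivity (\sum_(k < n) \sum_(i < n | (i <= k)%N) F i (k - i)%N).
  apply: eq_bigr => k _.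
  by rewrite (big_ord_widen_cond n xpredT (fun i => F i (k - i)%N)).
rewrite (exchange_big_dep xpredT) //=; apply: eq_bigr => i _.
have le_in := ltnW (ltn_ord i).
transitivity (\sum_(0 <= k < n | (i <= k)%N) F i (k - i)%N).
  by rewrite big_mkord.
transitivity (\sum_(0 <= j < n) F i j); last by rewrite big_mkord.
rewrite (big_cat_nat (n := i)) //= big_nat_cond big1 ?add0r => [|k]; last first.
  by case: ltngtP; rewrite ?andbF.
rewrite -{1}[nat_of_ord i]add0n big_addn.
rewrite [RHS](big_cat_nat (n := (n - i)%N)) ?leq_subr //=.
rewrite [X in _ = _ + X]big_nat_cond [X in _ = _ + X]big1 ?addr0 => [|j].
  by apply: eq_big => [j|j _]; rewrite ?leq_addl ?addnK.
by rewrite andbT leq_subLR => /andP[le_n _]; rewrite /F ad_x0_nilp ?scaler0.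
Qed.

End LieAlgebra.

Section LieGroup.
Variables (R : realType) (n : nat).

(* F_n = R^n ><| R, where t : R acts on R^n by exp (t ad x_0); (a, v) stands
   for exp (v_1 x_1 + ... + v_n x_n) exp (a x_0).  The underlying manifold is
   the simply connected space R x R^n, and [lie_algebra_filiform] below
   computes the Lie algebra. *)
Definition filiform : Type := (R * 'cV[R]_n)%type.
HB.instance Definition _ := Choice.copy filiform (R * 'cV[R]_n)%type.
HB.instance Definition _ := Topological.copy filiform (R * 'cV[R]_n)%type.

Definition filiform_mul (g h : filiform) : filiform :=
  (g.1 + h.1, g.2 + exp_ad_x0 n g.1 *m h.2).

Definition filiform_inv (g : filiform) : filiform :=
  (- g.1, - (exp_ad_x0 n (- g.1) *m g.2)).

Fact filiform_mulA : associative filiform_mul.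
Proof.
move=> g h k; rewrite /filiform_mul /= addrA exp_ad_x0_D.
by rewrite mulmxDr addrA mulmxA.
Qed.

Fact filiform_mul1 : left_id ((0, 0) : filiform) filiform_mul.
Proof.
by case=> a v; rewrite /filiform_mul /= !add0r exp_ad_x0_0 mul1mx.
Qed.

Fact filiform_1mul : right_id ((0, 0) : filiform) filiform_mul.
Proof. by case=> a v; rewrite /filiform_mul /= mulmx0 !addr0. Qed.

Fact filiform_mulV : left_inverse ((0, 0) : filiform) filiform_inv filiform_mul.
Proof. by case=> a v; rewrite /filiform_mul /= !addNr. Qed.

Fact filiform_Vmul :
  right_inverse ((0, 0) : filiform) filiform_inv filiform_mul.
Proof.
case=> a v; rewrite /filiform_mul /= subrr mulmxN mulmxA -exp_ad_x0_D subrr.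
by rewrite exp_ad_x0_0 mul1mx subrr.
Qed.

HB.instance Definition _ := isGroup.Build filiform
  filiform_mulA filiform_mul1 filiform_1mul filiform_mulV filiform_Vmul.

(* Derivative at 0, in the global coordinates of F_n. *)
Definition velocity (c : R -> filiform) : filiform_lie R n :=
  (derive1 (fun t => (c t).1) 0, \col_i derive1 (fun t => (c t).2 i 0) 0).

(* A curve through 1 with velocity X; any other one would do in [Ad] and in
   [lie_algebra_filiform]. *)
Definition ray (X : filiform_lie R n) (t : R) : filiform := t *: X.

Definition Ad (g : filiform) (Y : filiform_lie R n) : filiform_lie R n :=
  velocity (fun t => (g * ray Y t * g^-1)%g).

Fact derive1_poly (f : R -> R) (p : {poly R}) :
  f =1 horner p -> derive1 f 0 = p`_1.
Proof.
move=> /funext ->; rewrite -derivE horner_coef0 coef_deriv.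
by rewrite mulr1n.
Qed.

Fact exp_ad_x0_poly (b : R) (v : 'cV[R]_n) (i : 'I_n) :
  {p : {poly R} | (fun t => (exp_ad_x0 n (t * b) *m v) i 0) =1 horner p
     & p`_1 = (b *: (ad_x0 R n *m v)) i 0}.
Proof.
pose c k := (ad_x0 R n ^+ k *m v) i 0.
exists (\poly_(k < n) (b ^+ k / k`!%:R * c k)) => [t|].
  rewrite horner_poly /exp_ad_x0 mulmx_suml summxE; apply: eq_bigr => k _.
  by rewrite -scalemxAl mxE /c exprMn; ring.
rewrite coef_poly mxE /c; case: ltnP => [_|le_n1].
  by rewrite !expr1 divr1.
by rewrite -[ad_x0 R n]expr1 ad_x0_nilp // mul0mx mxE mulr0.
Qed.

Lemma AdE g Y :
  Ad g Y = (Y.1, exp_ad_x0 n g.1 *m Y.2 - Y.1 *: (ad_x0 R n *m g.2)).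
Proof.
case: g Y => a v [b w]; rewrite /Ad /velocity /=; congr pair.
  rewrite (@derive1_poly _ (b *: 'X)) => [|t].
    by rewrite coefZ coefX mulr1.
  by rewrite !hornerE /= addrAC subrr add0r mulrC.
apply/colP => i; rewrite !mxE.
have [p pE p1] := exp_ad_x0_poly b v i.
set u := exp_ad_x0 n a *m w.
rewrite (@derive1_poly _ ((v i 0)%:P + u i 0 *: 'X - p)) => [|t].
  by rewrite coefB p1 coefD coefC add0r coefZ coefX mulr1 [X in _ - X]mxE !mxE.
rewrite !hornerE -pE /= mulmxN mulmxA -exp_ad_x0_D.
have -> : a + t * b - a = t * b by ring.
rewrite -scalemxAr -/u.
by move: (exp_ad_x0 n (t * b) *m v) => z; rewrite !mxE; ring.
Qed.

(* The bracket of the Lie algebra of F_n is the differential of Ad at 1. *)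
Lemma lie_algebra_filiform X Y :
  velocity (fun s => Ad (ray X s) Y) = bracket X Y.
Proof.
case: X Y => a v [b w]; rewrite /velocity /bracket; congr pair.
  by under [F in derive1 F]funext do rewrite AdE; rewrite derive1_cst.
apply/colP => i; rewrite mxE.
have [p pE p1] := exp_ad_x0_poly a w i.
rewrite (@derive1_poly _ (p - (b *: (ad_x0 R n *m v)) i 0 *: 'X)) => [|t].
  by rewrite coefB p1 coefZ coefX mulr1 [RHS]mxE [X in _ = _ + X]mxE.
rewrite AdE !hornerE -pE /= mxE [X in _ + X]mxE; congr (_ - _).
by rewrite -scalemxAr !mxE; ring.
Qed.

(* H_n = exp (Span{x_1, ..., x_n}).  For n >= 3 it is the only maximal abelian
   normal subgroup of F_n.  F_2 is the Heisenberg group, whose maximal abelian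
   normal subgroups are the images of H_2 under its automorphisms, i.e. the
   groups exp (Span{y, x_2}) for y not in R x_2; a lattice need not meet H_2 in
   a lattice of H_2, but it does so for one of these. *)
Definition Hn : {pred filiform} := fun g => g.1 == 0.

End LieGroup.
Arguments Hn : clear implicits.

(* Discrete and cocompact, F_n / Gamma carrying the quotient topology. *)
Definition is_lattice (R : realType) (n : nat)
    (Gamma : groupClosed (filiform R n)) : Prop :=
  isolated [set x | x \in Gamma] = [set x | x \in Gamma] /\
  compact [set: quotient_topology (cosets Gamma)].

Section SemidirectZ.
Variable N : groupType.

Record Zaction := {
  Zact :> int -> N -> N;
  ZactM : forall k, {morph Zact k : x y / (x * y)%g};
  Zact0 : forall x, Zact 0 x = x;
  ZactD : forall k m x, Zact (k + m) x = Zact k (Zact m x)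
}.

Definition sdprodZ & Zaction : Type := (N * int)%type.

Variable phi : Zaction.
Local Notation S := (sdprodZ phi).

HB.instance Definition _ := Choice.copy S (N * int)%type.

Definition sdprodZ_mul (a b : S) : S :=
  ((a.1 * phi a.2 b.1)%g, a.2 + b.2).

Definition sdprodZ_inv (a : S) : S :=
  (phi (- a.2) (a.1^-1)%g, - a.2).

Fact Zact1 k : phi k 1%g = 1%g.
Proof. by apply: (mulIg (phi k 1%g)); rewrite -ZactM !mul1g. Qed.

Fact sdprodZ_mulA : associative sdprodZ_mul.
Proof.
by move=> a b c; rewrite /sdprodZ_mul /= ZactM ZactD mulgA addrA.
Qed.

Fact sdprodZ_mul1 : left_id ((1%g, 0) : S) sdprodZ_mul.
Proof. by case=> x k; rewrite /sdprodZ_mul /= Zact0 mul1g add0r. Qed.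

Fact sdprodZ_1mul : right_id ((1%g, 0) : S) sdprodZ_mul.
Proof. by case=> x k; rewrite /sdprodZ_mul /= Zact1 mulg1 addr0. Qed.

Fact sdprodZ_mulV : left_inverse ((1%g, 0) : S) sdprodZ_inv sdprodZ_mul.
Proof.
by case=> x k; rewrite /sdprodZ_mul /= -ZactM mulVg Zact1 addNr.
Qed.

Fact sdprodZ_Vmul :
  right_inverse ((1%g, 0) : S) sdprodZ_inv sdprodZ_mul.
Proof.
by case=> x k; rewrite /sdprodZ_mul /= -ZactD subrr Zact0 mulgV.
Qed.

HB.instance Definition _ := isGroup.Build S
  sdprodZ_mulA sdprodZ_mul1 sdprodZ_1mul sdprodZ_mulV sdprodZ_Vmul.

End SemidirectZ.

Definition isomorphic (G1 G2 : groupType) : Prop :=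
  exists f : {multiplicative G1 -> G2}, bijective f.

Section Basis.
Variables (N : groupType) (n : nat).
Implicit Types (e : 'I_n -> N) (c : 'cV[int]_n).

Definition expgz (x : N) (m : int) : N :=
  match m with Posz k => (x ^+ k)%g | Negz k => (x ^- k.+1)%g end.

Definition Zcomb e c : N := (\prod_(i < n) expgz (e i) (c i 0))%g.

Definition is_Zbasis e : Prop := forall x : N, exists! c, x = Zcomb e c.

(* Column l of A lists the coordinates of u (e l). *)
Definition has_matrix e (u : N -> N) (A : 'M[int]_n) : Prop :=
  forall l, u (e l) = Zcomb e (col l A).

End Basis.

Definition unipotent_mx (n : nat) (A : 'M[int]_n) : Prop :=
  exists k, (A - 1%:M) ^+ k = 0.

(* Main.v *)
From HB Require Import structures.
Require Import Defs.
From mathcomp Require Import all_boot all_order all_algebra.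
From mathcomp Require Import all_classical all_reals all_analysis.
From mathcomp Require Import zify ring lra.
Import Order.TTheory GRing.Theory Num.Theory.
Import numFieldNormedType.Exports.
Set Implicit Arguments.
Unset Strict Implicit.
Unset Printing Implicit Defensive.
Local Open Scope ring_scope.
Local Open Scope quotient_scope.

(** Write [U t = exp (t ad x_0) - 1]. On Span{x_1, ..., x_n} it shifts the
    first nonzero coordinate one place down and multiplies it by [t]. Since
    commutators with [(t, _)] in Gamma act on the elements of Gamma in H_n by
    [U t], iterating brings the leading coordinate of any such element, times a
    power of [t], into the discrete group of the s with s x_n in Gamma.
    Cocompactness is used only once: Gamma is not contained in the kernel of a
    nonzero homomorphism F_n -> R, so it contains g, h with independent images
    in F_n / [F_n, F_n] = R^2.

    For n >= 3 the commutator of g and h has a nonzero x_2-coordinate, and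
    applying [U t] to it n - 2 times shows that the projection of Gamma to
    F_n / H_n is discrete, hence infinite cyclic, generated by some [t]. A
    product g^k h^-m lying in H_n has a nonzero x_1-coordinate, and its images
    under the powers of [U t] have leading coordinates in every position. So
    the k-th coordinates of the elements of L vanishing below position k form
    an infinite cyclic group for every k. Elements of L whose coordinates
    generate these groups form the basis, in which the shifting property of
    [U t] says that the action is lower unitriangular.

    For n = 2 the determinant form omega on F_2 / [F_2, F_2] takes discrete
    values on Gamma, and H is chosen as the kernel of [omega g]. *)

(** * Discrete subgroups of the real line *)

(** Euclidean descent: a nonzero [s] in [S] that does not generate [S] can be replaced by a nonzero
    element shorter by at least [eps], so the descent stops. *)
Lemma discrete_subgroup_cyclic (R : realType) (S : R -> Prop) (eps : R) :
    (forall x y, S x -> S y -> S (x - y)) -> 0 < eps ->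
    (forall x, S x -> `|x| < eps -> x = 0) -> (exists2 x, S x & x != 0) ->
  exists t, [/\ S t, t != 0 & forall x, S x -> exists m : int, x = m%:~R * t].
Proof.
move=> SB eps0 Seps [s Ss s0].
have S0 : S 0 by rewrite -(subrr s); exact: SB.
have SN x : S x -> S (- x) by rewrite -sub0r; exact: SB.
have SD x y : S x -> S y -> S (x + y).
  by move=> Sx Sy; rewrite -[y]opprK; apply: SB => //; apply: SN.
have SMn x k : S x -> S (x *+ k).
  by move=> Sx; elim: k => [|k IH]; rewrite ?mulr0n // mulrS; apply: SD.
have SMz x (m : int) : S x -> S (m%:~R * x).
  move=> Sx; rewrite mulrzl; case: m => k; first exact: SMn.
  by rewrite NegzE mulrNz; apply/SN/SMn.
have [N] : exists N : nat, `|s| < N%:R * eps.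
  exists (Num.trunc (`|s| / eps)).+1.
  by rewrite -ltr_pdivrMr // truncnS_gt.
elim: N s Ss s0 => [|N IH] s Ss s0 sN.
  by have := normr_ge0 s; lra.
have [|/existsNP[x /not_implyP[Sx /forallNP xm]]] :=
  pselect (forall x, S x -> exists m : int, x = m%:~R * s); first by exists s.
pose m := Num.floor (x / s); pose q := x / s - m%:~R.
have xE : x = (m%:~R + q) * s by rewrite /q addrC subrK divfK.
have q_ge0 : 0 <= q by rewrite subr_ge0 Num.Theory.floor_le.
have q_lt1 : q < 1 by rewrite ltrBlDl -intrD1 Num.Theory.floorD1_gt.
have q_gt0 : 0 < q.
  rewrite lt_neqAle q_ge0 andbT eq_sym; apply/eqP => q0.
  by apply: (xm m); rewrite {1}xE q0 addr0.
have Sy : S (q * s).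
  by have := SB _ _ Sx (SMz _ m Ss); rewrite {1}xE -mulrBl addrAC subrr add0r.
(* The remainder [q * s] may be barely shorter than [s]; but [q * |s| >= eps] by discreteness, so
   [q * s - s] has length at most [|s| - eps]. *)
apply: (IH (q * s - s)); first exact: SB.
  by rewrite -[X in _ - X]mul1r -mulrBl mulf_neq0 // subr_eq0 lt_eqF.
have y_ge : eps <= q * `|s|.
  rewrite leNgt; apply/negP => lt.
  have /eqP : q * s = 0 by apply: Seps; rewrite // normrM ger0_norm.
  by rewrite mulf_eq0 (negbTE s0) (gt_eqF q_gt0).
rewrite -[X in _ - X]mul1r -mulrBl normrM ler0_norm ?subr_le0 1?ltW // opprB.
by move: sN; rewrite -natr1; lra.
Qed.

(** * Homomorphisms to abelian groups, and integer powers *)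

Section AdditiveMaps.
Variables (G : groupType) (V : zmodType) (f : G -> V).
Hypothesis fM : {morph f : x y / (x * y)%g >-> x + y}.

Lemma additive1 : f 1%g = 0.
Proof. by apply: (addrI (f 1%g)); rewrite -fM mulg1 addr0. Qed.

Lemma additiveV : {morph f : x / (x^-1)%g >-> - x}.
Proof.
by move=> x; apply: (addrI (f x)); rewrite -fM mulgV additive1 subrr.
Qed.

Lemma additive_expgz x m : f (expgz x m) = f x *~ m.
Proof.
have fX k : f (x ^+ k)%g = f x *+ k.
  by elim: k => [|k IH]; [exact: additive1 | rewrite expgS mulrS fM IH].
case: m => k; first exact: fX.
by rewrite NegzE mulrNz /expgz additiveV fX.
Qed.

End AdditiveMaps.

Section IntegerPowers.
Variable G : groupType.
Implicit Types (x : G) (m : int).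

Lemma expgz_succ x m : expgz x (m + 1) = (expgz x m * x)%g.
Proof.
case: m => [k|[|k]].
- by rewrite -PoszD /= addn1 expgSr.
- by rewrite NegzE addNr /= expg0 expg1 mulVg.
rewrite NegzE -addn1 PoszD opprD subrK -[- _]/(Negz k).
by rewrite /= addn0 [in RHS]expgS invgM mulgVK.
Qed.

Lemma expgzD x m1 m2 : expgz x (m1 + m2) = (expgz x m1 * expgz x m2)%g.
Proof.
elim/int_rect: m2 => [|k IH|k IH].
- by rewrite addr0 mulg1.
- by rewrite -addn1 PoszD addrA !expgz_succ IH mulgA.
apply: (mulIg x); rewrite -mulgA -!expgz_succ -addrA.
by have -> : - k.+1%:Z + 1 = - k%:Z by lia.
Qed.

End IntegerPowers.

Definition in_subgroup (G : groupType) (L : groupClosed G) (x : G)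
  (xL : x \in L) : subgroup L := exist (fun y => y \in L) x xL.

Lemma in_subgroupK (G : groupType) (L : groupClosed G) (x : G) (xL : x \in L) :
  val (in_subgroup xL) = x.
Proof. by []. Qed.

(** * Splitting of extensions by an infinite cyclic group *)

Section CyclicExtension.
Variables (R : numDomainType) (G : groupType) (L : groupClosed G) (h : G -> R).
Variable t : G.
Hypothesis hM : {morph h : x y / (x * y)%g >-> x + y}.
Hypothesis LE : forall x, (x \in L) = (h x == 0).
Hypothesis t0 : h t != 0.
Hypothesis hZ : forall x, exists m : int, h x = m%:~R * h t.

Let hX x m : h (expgz x m) = h x *~ m.
Proof. exact: additive_expgz. Qed.

(** [L] is the kernel of [h], and the quotient is free on the class of [t], so the powers of [t]
    give a section. An element [x] with [h x = d * h t] decomposes as [x * t^-d] in [L] times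
    [t^d]. *)
Lemma cyclic_extension_split : exists phi : Zaction (subgroup L),
  (forall x, val (phi 1 x) = (t * val x * t^-1)%g) /\
  isomorphic G (sdprodZ phi).
Proof.
have conj_in k (x : subgroup L) : (expgz t k * val x * (expgz t k)^-1)%g \in L.
  have /eqP hx : h (val x) == 0 by rewrite -LE; exact: valP.
  by rewrite LE !hM hx (additiveV hM) addr0 subrr.
pose act k (x : subgroup L) : subgroup L := in_subgroup (conj_in k x).
have actM k : {morph act k : x y / (x * y)%g}.
  by move=> x y; apply: val_inj; rewrite valM !in_subgroupK !mulgA mulgVK.
have act0 x : act 0 x = x.
  by apply: val_inj; rewrite in_subgroupK invg1 mulg1 mul1g.
have actD k m x : act (k + m) x = act k (act m x).
  by apply: val_inj; rewrite !in_subgroupK expgzD invgM !mulgA.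
pose phi := Build_Zaction actM act0 actD.
exists phi; split=> [x|]; first by rewrite in_subgroupK.
have [d dE] := choice hZ.
have dM : {morph d : x y / (x * y)%g >-> x + y}.
  move=> x y; apply: (@intr_inj R); apply: (mulIf t0).
  by rewrite -dE hM (dE x) (dE y) intrD mulrDl.
have part_in x : (x * (expgz t (d x))^-1)%g \in L.
  by rewrite LE hM (additiveV hM) hX dE mulrzl subrr.
pose f (x : G) : sdprodZ phi := (in_subgroup (part_in x), d x).
pose g (y : sdprodZ phi) : G := (val y.1 * expgz t y.2)%g.
have fM : {morph f : x y / (x * y)%g}.
  move=> x y; congr pair; last exact: dM.
  by apply: val_inj; rewrite valM !in_subgroupK dM expgzD invgM !mulgA mulgVK.
have fK : cancel f g by move=> x; rewrite /g in_subgroupK mulgVK.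
have gK : cancel g f.
  case=> x k; have dk : d (val x * expgz t k)%g = k.
    apply: (@intr_inj R); apply: (mulIf t0).
    have /eqP hx : h (val x) == 0 by rewrite -LE; exact: valP.
    by rewrite -dE hM hX hx add0r mulrzl.
  by congr pair => //; apply: val_inj; rewrite in_subgroupK /g /= dk mulgK.
pose fmult := isMultiplicative.Build G (sdprodZ phi) f fM.
pose F : {multiplicative G -> sdprodZ phi} := HB.pack f fmult.
by exists F; exists g.
Qed.

End CyclicExtension.

(** * Filtration by leading position, and bases adapted to it *)

(** Positions count from 0: for coordinates in x_1, ..., x_n this is Span{x_{k+1}, ..., x_n}. It
    also serves for columns of integer coefficients. *)
Definition vanishes_below (R : zmodType) n (k : nat) (v : 'cV[R]_n) : Prop :=
  forall i : 'I_n, (i < k)%N -> v i 0 = 0.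

Lemma vanishes_belowB (R : zmodType) n k (v w : 'cV[R]_n) :
  vanishes_below k v -> vanishes_below k w -> vanishes_below k (v - w).
Proof. by move=> v0 w0 i ik; rewrite !mxE v0 ?w0 ?subr0. Qed.

Lemma vanishes_below_all (R : zmodType) n (v : 'cV[R]_n) :
  vanishes_below n v -> v = 0.
Proof. by move=> v0; apply/colP => i; rewrite mxE v0. Qed.

Lemma vanishes_belowS (R : zmodType) n (k : 'I_n) (v : 'cV[R]_n) :
  vanishes_below k v -> v k 0 = 0 -> vanishes_below k.+1 v.
Proof.
move=> v0 vk i; rewrite ltnS leq_eqVlt => /predU1P[/val_inj -> //|].
exact: v0.
Qed.

(** Each factor [A] pushes the support one diagonal further down. *)
Lemma strictly_lower_nilpotent (R : pzRingType) n (A : 'M[R]_n) :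
  (forall i j : 'I_n, (i <= j)%N -> A i j = 0) -> A ^+ n = 0.
Proof.
move=> A0; have AX m (i j : 'I_n) : (i < j + m)%N -> (A ^+ m) i j = 0.
  elim: m i j => [|m IH] i j ij.
    by rewrite expr0 mxE -val_eqE ltn_eqF // -[X in (_ < X)%N]addn0.
  rewrite exprS mxE big1 // => k _; have [ik|ki] := leqP i k.
    by rewrite A0 ?mul0r.
  by rewrite IH ?mulr0 //; lia.
by apply/matrixP => i j; rewrite AX ?mxE // ltn_addl.
Qed.

Section FilteredBasis.
Variables (R : realType) (n : nat) (N : groupType) (pi : N -> 'cV[R]_n).
Variable e : 'I_n -> N.
Hypothesis piM : {morph pi : x y / (x * y)%g >-> x + y}.
Hypothesis pi_inj : injective pi.
Hypothesis e_low : forall k : 'I_n, vanishes_below k (pi (e k)).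
Hypothesis e_lead : forall k : 'I_n, pi (e k) k 0 != 0.
Hypothesis e_gen : forall (k : 'I_n) x, vanishes_below k (pi x) ->
  exists m : int, pi x k 0 = m%:~R * pi (e k) k 0.

Lemma pi_Zcomb c : pi (Zcomb e c) = \sum_(i < n) pi (e i) *~ c i 0.
Proof.
rewrite /Zcomb (big_morph pi piM (additive1 piM)).
by apply: eq_bigr => i _; rewrite additive_expgz.
Qed.

(** Forward substitution: in coordinate [k] the terms after [k] vanish by [e_low] and those before
    [k] by induction, which leaves [c k 0] times a nonzero number. *)
Lemma pi_Zcomb_eq0 c : pi (Zcomb e c) = 0 -> c = 0.
Proof.
rewrite pi_Zcomb => c0; apply/colP => k; rewrite mxE.
have [m] := ubnP (k : nat); elim: m k => // m IH k; rewrite ltnS => km.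
move/matrixP/(_ k 0): c0; rewrite summxE (bigD1 k) //= big1 ?addr0 => [|i ik].
  rewrite -scaler_int !mxE => /eqP.
  by rewrite mulf_eq0 (negbTE (e_lead k)) orbF intr_eq0 => /eqP.
have [lt_ik|lt_ki|/val_inj eq_ik] := ltngtP i k.
- by rewrite IH ?mulr0z ?mxE //; apply: leq_trans km.
- by rewrite -scaler_int mxE e_low // mulr0.
- by rewrite eq_ik eqxx in ik.
Qed.

(** Descending induction on [k]: dividing by a power of [e k] given by [e_gen] clears coordinate
    [k]. The support of the coefficients is recorded because it makes the matrix of the action
    triangular. *)
Lemma Zcomb_of_vanishing x (k : nat) : (k <= n)%N -> vanishes_below k (pi x) ->
  exists2 c, x = Zcomb e c & vanishes_below k c.
Proof.
move: {2}(n - k)%N (erefl (n - k)%N) => m.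
elim: m k x => [|m IH] k x mE kn x0.
  have kE : k = n by lia.
  rewrite kE in x0 *; exists 0; last by move=> i _; rewrite mxE.
  apply: pi_inj; rewrite (vanishes_below_all x0) pi_Zcomb big1 // => i _.
  by rewrite mxE.
have lt_kn : (k < n)%N by lia.
pose k' := Ordinal lt_kn; have [d xk] := e_gen (x0 : vanishes_below k' _).
pose y := (x * (expgz (e k') d)^-1)%g.
have piy : pi y = pi x - pi (e k') *~ d.
  by rewrite piM additiveV // additive_expgz.
have [|//||c yE c0] := IH k.+1 y; first by lia.
  rewrite piy; apply: (@vanishes_belowS _ _ k').
    by apply: vanishes_belowB => // i ik; rewrite -scaler_int mxE e_low ?mulr0.
  by rewrite -scaler_int !mxE xk subrr.
exists (c + \col_i (d *+ (i == k'))) => [|i ik]; last first.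
  rewrite !mxE c0 1?ltnW // add0r; case: eqP ik => [->|//].
  by rewrite ltnn.
apply: pi_inj; rewrite pi_Zcomb.
under eq_bigr do rewrite !mxE mulrzDr.
rewrite big_split /= -pi_Zcomb -yE piy (bigD1 k') //= eqxx big1 ?addr0 ?subrK //.
by move=> i /negbTE ->.
Qed.

Lemma filtered_Zbasis : is_Zbasis e.
Proof.
move=> x; have [//||c xE _] := @Zcomb_of_vanishing x 0 => //.
exists c; split=> // c' xE'; apply/eqP; rewrite -subr_eq0; apply/eqP.
apply: pi_Zcomb_eq0; rewrite pi_Zcomb.
under eq_bigr do rewrite !mxE mulrzBr.
by rewrite sumrB -!pi_Zcomb -xE -xE' subrr.
Qed.

(** Column [l] of [g1 - 1] lists the coefficients of [u (e l) * (e l)^-1], which start strictly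
    after position [l]. *)
Lemma filtered_lower_matrix (u : N -> N) :
    (forall l : 'I_n, vanishes_below l.+1 (pi (u (e l)) - pi (e l))) ->
  exists a : 'M[int]_n,
    let g1 : 'M[int]_n :=
      1%:M + \sum_(k < n) \sum_(l < n | (l < k)%N) a k l *: delta_mx k l in
    unipotent_mx g1 /\ has_matrix e u g1.
Proof.
move=> ue; have uE l : exists c : 'cV[int]_n,
    (u (e l) * (e l)^-1)%g = Zcomb e c /\ vanishes_below l.+1 c.
  have [//||c] := @Zcomb_of_vanishing (u (e l) * (e l)^-1)%g l.+1; last by exists c.
  by rewrite piM (additiveV piM); exact: ue.
have [c cE] := choice uE.
exists (\matrix_(k, l) c l k 0) => g1.
have sE k l : (g1 - 1%:M) k l = if (l < k)%N then c l k 0 else 0.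
  rewrite /g1 addrAC subrr add0r summxE (bigD1 k) //= [X in _ + X]big1 => [|i ik].
    rewrite addr0 summxE big_mkcond (bigD1 l) //= big1 => [|j jl].
      by rewrite !mxE !eqxx mulr1 addr0.
    by case: ifP => // _; rewrite !mxE eqxx eq_sym (negbTE jl) mulr0.
  by rewrite summxE big1 // => j _; rewrite !mxE eq_sym (negbTE ik) mulr0.
split=> [|l].
  by exists n; apply: strictly_lower_nilpotent => i j ij; rewrite sE ltnNge ij.
have [ul cl] := cE l; apply: pi_inj; rewrite pi_Zcomb.
have gE k : (col l g1) k 0 = (k == l)%:R + c l k 0.
  rewrite mxE -[g1](subrK 1%:M) [LHS]mxE sE addrC mxE; congr (_ + _).
  by case: ltnP => // kl; rewrite cl.
under eq_bigr do rewrite gE mulrzDr.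
rewrite big_split /= -pi_Zcomb -ul piM (additiveV piM).
rewrite (bigD1 l) //= eqxx big1 => [|i /negbTE -> //].
by rewrite addr0 addrC subrK.
Qed.

End FilteredBasis.

(** * A criterion for unipotent splittings *)

(** The last clause of the theorem, freed from [Gamma] and [H] so that the cases [n >= 3] and
    [n = 2] share one criterion. *)
Definition unipotent_splitting (G : groupType) (L : groupClosed G) n : Prop :=
  exists (phi : Zaction (subgroup L)) (e : 'I_n -> subgroup L) (a : 'M[int]_n),
    let g1 : 'M[int]_n :=
      1%:M + \sum_(k < n) \sum_(l < n | (l < k)%N) a k l *: delta_mx k l in
    [/\ is_Zbasis e, unipotent_mx g1, has_matrix e (phi 1) g1 &
        isomorphic G (sdprodZ phi)].

(** For each [k] the leading coordinates at position [k] form a nonzero discrete group; elements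
    realizing its generators make up the basis [e]. The map [pi] is left free because [n = 2] calls
    for adapted coordinates. *)
Lemma filtered_extension (R : realType) n (G : groupType) (L : groupClosed G)
    (h : G -> R) (t : G) (pi : subgroup L -> 'cV[R]_n) :
    {morph h : x y / (x * y)%g >-> x + y} ->
    (forall x, (x \in L) = (h x == 0)) ->
    h t != 0 -> (forall x, exists m : int, h x = m%:~R * h t) ->
    {morph pi : x y / (x * y)%g >-> x + y} -> (forall x, pi x = 0 -> x = 1%g) ->
    (forall (k : 'I_n) (x y : subgroup L), val y = (t * val x * t^-1)%g ->
      vanishes_below k (pi x) -> vanishes_below k.+1 (pi y - pi x)) ->
    (forall k : 'I_n, exists2 eps : R, 0 < eps & forall x,
      vanishes_below k (pi x) -> `|pi x k 0| < eps -> pi x k 0 = 0) ->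
    (forall k : 'I_n, exists2 x, vanishes_below k (pi x) & pi x k 0 != 0) ->
  unipotent_splitting L n.
Proof.
move=> hM LE t0 hZ piM pi1 tU disc lead.
have [phi [phi1 iso]] := cyclic_extension_split hM LE t0 hZ.
have pi_inj : injective pi.
  by move=> x y xy; apply/divg1_eq/pi1; rewrite piM additiveV // xy subrr.
have eP (k : 'I_n) : exists x, [/\ vanishes_below k (pi x), pi x k 0 != 0 &
    forall y, vanishes_below k (pi y) ->
      exists m : int, pi y k 0 = m%:~R * pi x k 0].
  have [eps eps0 epsP] := disc k; have [x x_low xk] := lead k.
  pose S s := exists2 x, vanishes_below k (pi x) & s = pi x k 0.
  have [|//||| s [[y y_low ->] yk sP]] := @discrete_subgroup_cyclic R S eps.
  - move=> _ _ [y y_low ->] [z z_low ->]; exists (y * z^-1)%g.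
      by rewrite piM additiveV //; apply: vanishes_belowB.
    by rewrite piM additiveV // !mxE.
  - by move=> _ [y y_low ->]; exact: epsP.
  - by exists (pi x k 0) => //; exists x.
  by exists y; split=> // z z_low; apply: sP; exists z.
have [e eE] := choice eP.
have e_low (k : 'I_n) : vanishes_below k (pi (e k)) by have [] := eE k.
have e_lead k : pi (e k) k 0 != 0 by have [] := eE k.
have e_gen (k : 'I_n) x : vanishes_below k (pi x) ->
    exists m : int, pi x k 0 = m%:~R * pi (e k) k 0.
  by have [_ _] := eE k; apply.
have [l|a [a_unip aE]] := filtered_lower_matrix piM pi_inj e_low e_gen (u := phi 1).
  exact/tU.
by exists phi, e, a; split=> //; exact: filtered_Zbasis.
Qed.

Lemma discrete_image_cyclic (R : realType) (G : groupType) (f : G -> R) eps :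
    {morph f : x y / (x * y)%g >-> x + y} -> 0 < eps ->
    (forall x, `|f x| < eps -> f x = 0) -> (exists x, f x != 0) ->
  exists2 t, f t != 0 & forall x, exists m : int, f x = m%:~R * f t.
Proof.
move=> fM eps0 disc [x fx].
pose S s := exists y, s = f y.
have [_ _ [y ->] [z ->]|//|_ [y ->]||s [[t ->] ft sP]] :=
  @discrete_subgroup_cyclic R S eps.
- by exists (y * z^-1)%g; rewrite fM (additiveV fM).
- exact: disc.
- by exists (f x) => //; exists x.
by exists t => // y; apply: sP; exists y.
Qed.

(** * Computations in F_n, and discreteness in its lattices *)

Section FiliformLattice.
Variables (R : realType) (n : nat).
Implicit Types (g h : filiform R n) (v w : 'cV[R]_n) (t : R) (i j : 'I_n).

Lemma filiform_mulE g h : (g * h)%g = (g.1 + h.1, g.2 + exp_ad_x0 n g.1 *m h.2).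
Proof. by []. Qed.

Lemma filiform_invE g : (g^-1)%g = (- g.1, - (exp_ad_x0 n (- g.1) *m g.2)).
Proof. by []. Qed.

Lemma exp_ad_x0E t i j : exp_ad_x0 n t i j =
  if (j <= i)%N then t ^+ (i - j) / (i - j)`!%:R else 0.
Proof.
rewrite /exp_ad_x0 summxE; case: leqP => ij.
  have lt_n : (i - j < n)%N by have := ltn_ord i; lia.
  rewrite (bigD1 (Ordinal lt_n)) //= mxE ad_x0_exp subnKC // eqxx mulr1.
  rewrite big1 ?addr0 // => k; rewrite -val_eqE /= => kij.
  rewrite mxE ad_x0_exp; case: eqP => [ijk|]; last by rewrite mulr0.
  by case/eqP: kij; lia.
rewrite big1 // => k _; rewrite mxE ad_x0_exp ltn_eqF ?mulr0 //.
exact: ltn_addr.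
Qed.

(** The matrix [U t] of the overview: the commutator of [(t, _)] with [(0, v)] is
    [(0, unip t *m v)]. *)
Definition unip t : 'M[R]_n := exp_ad_x0 n t - 1%:M.

Lemma unipE t i j : (i <= j)%N -> unip t i j = 0.
Proof.
move=> ij; rewrite !mxE exp_ad_x0E -val_eqE /=; case: ltngtP ij => //= [_|->] _.
  by rewrite subr0.
by rewrite subnn expr0 divr1 subrr.
Qed.

Lemma unip_sub t i j : i = j.+1 :> nat -> unip t i j = t.
Proof.
move=> ij; rewrite !mxE exp_ad_x0E -val_eqE /= ij leqnSn subSnn expr1 divr1.
by rewrite gtn_eqF // subr0.
Qed.

Lemma unip_low k t v : vanishes_below k v -> vanishes_below k.+1 (unip t *m v).
Proof.
move=> v0 i ik; rewrite mxE big1 // => j _.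
have [jk|kj] := ltnP j k; first by rewrite v0 ?mulr0.
by rewrite unipE ?mul0r // (leq_trans _ kj).
Qed.

(** Row [i + 1] of [unip t] is supported on columns up to [i], and [v] vanishes before [i], so only
    the subdiagonal entry [t] contributes. *)
Lemma unip_lead t v i j : j = i.+1 :> nat -> vanishes_below i v ->
  (unip t *m v) j 0 = t * v i 0.
Proof.
move=> ij v0; rewrite mxE (bigD1 i) //= unip_sub // big1 ?addr0 // => k ki.
have [lt_ki|lt_ik|/val_inj eq_ik] := ltngtP k i.
- by rewrite v0 ?mulr0.
- by rewrite unipE ?mul0r // ij.
- by rewrite eq_ik eqxx in ki.
Qed.

Lemma unip_iter_low k m t v : vanishes_below k v ->
  vanishes_below (k + m) (iter m (mulmx (unip t)) v).
Proof.
by move=> v0; elim: m => [|m IH]; rewrite ?addn0 // addnS; apply: unip_low.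
Qed.

Lemma unip_iter_lead m t v i j : j = (i + m)%N :> nat -> vanishes_below i v ->
  iter m (mulmx (unip t)) v j 0 = t ^+ m * v i 0.
Proof.
elim: m j => [|m IH] j ij v0.
  by rewrite mul1r; congr (v _ 0); apply: val_inj; rewrite /= ij addn0.
have lt_n : (i + m < n)%N by have := ltn_ord j; lia.
rewrite /= (@unip_lead _ _ (Ordinal lt_n)) /= ?ij ?addnS //.
  by rewrite IH // exprS mulrA.
exact: unip_iter_low.
Qed.

Lemma exp_unip t v : exp_ad_x0 n t *m v = v + unip t *m v.
Proof. by rewrite mulmxBl mul1mx addrC subrK. Qed.

Lemma filiform_conj g v :
  (g * (0, v) * g^-1)%g = (0, v + unip g.1 *m v) :> filiform R n.
Proof.
rewrite !filiform_mulE filiform_invE /= -exp_unip; congr pair; first by ring.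
rewrite addr0 mulmxN mulmxA -exp_ad_x0_D subrr exp_ad_x0_0 mul1mx.
by rewrite addrAC subrr add0r.
Qed.

Lemma filiform_commutator g h :
  (g * h * (h * g)^-1)%g = (0, unip g.1 *m h.2 - unip h.1 *m g.2)
    :> filiform R n.
Proof.
apply: (mulIg (h * g)%g); rewrite mulgVK !filiform_mulE /= !exp_unip.
congr pair; first by ring.
have -> : unip 0 = 0 by rewrite /unip exp_ad_x0_0 subrr.
rewrite mul0mx addr0.
move: (unip g.1 *m h.2) (unip h.1 *m g.2) => x y.
by apply/colP => i; rewrite !mxE; ring.
Qed.

Lemma filiform_mul0 v w : (((0, v) : filiform R n) * (0, w))%g = (0, v + w).
Proof.
by rewrite filiform_mulE /= add0r exp_ad_x0_0 mul1mx.
Qed.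

Hypothesis n_gt0 : (0 < n)%N.
Let i0 := Ordinal n_gt0.
Let lt_pred : (n.-1 < n)%N. Proof. by rewrite prednK. Qed.
Let last := Ordinal lt_pred.

Definition x1_coord g : R := g.2 i0 0.

(** A lower unitriangular matrix fixes the first coordinate. Together with [g.1] this gives the map
    onto F_n / [F_n, F_n] = R^2. *)
Lemma x1_coordM : {morph x1_coord : g h / (g * h)%g >-> g + h}.
Proof.
move=> g h; rewrite /x1_coord filiform_mulE /= exp_unip mxE; congr (_ + _).
by rewrite mxE (unip_low (k := 0)) ?addr0.
Qed.

Variable Gamma : groupClosed (filiform R n).
Hypothesis Gamma_lattice : is_lattice Gamma.

(** A homomorphism to R that kills [Gamma] descends to a continuous function on the compact space
    F_n / Gamma, so it is bounded, hence zero. *)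
Lemma lattice_not_in_kernel (a b : R) :
  (forall g, g \in Gamma -> a * g.1 + b * x1_coord g = 0) -> a = 0 /\ b = 0.
Proof.
move=> ab0; pose f g := a * g.1 + b * x1_coord g.
have fM : {morph f : g h / (g * h)%g >-> g + h}.
  by move=> g h; rewrite /f x1_coordM /=; ring.
have f_cont : continuous f.
  move=> g; apply: cvgD; apply: cvgM; try exact: cvg_cst.
    exact: cvg_fst.
  apply: (continuous_comp (f := snd) (g := fun v : 'cV[R]_n => v i0 0)).
    exact: cvg_snd.
  exact: coord_continuous.
have fq : {homo f : x y / \pi_(quotient_topology (cosets Gamma)) x
    == \pi_(quotient_topology (cosets Gamma)) y >-> x == y}.
  move=> x y /eqP /cosetsP xy; rewrite eq_sym -subr_eq0 addrC.
  by rewrite -(additiveV fM) -fM /f ab0.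
have [_ cpt] := Gamma_lattice.
have fr_cont := repr_comp_continuous f_cont fq.
have := continuous_compact (continuous_subspaceT fr_cont) cpt.
move=> /compact_bounded [M [_ /(_ (M + 1))]]; rewrite ltrDl ltr01 => /(_ isT) fM1.
have bound x : `|f x| <= M + 1.
  apply: fM1; exists (\pi_(quotient_topology (cosets Gamma)) x) => //=.
  by apply/eqP/fq; rewrite reprK.
pose c := a ^+ 2 + b ^+ 2.
have c0 : 0 <= c by rewrite addr_ge0 ?sqr_ge0.
(* Over the direction [(a, b)] of R^2 the values of [f] grow linearly unless [a] and [b] are both
   0. *)
have fs s : f (s * a, const_mx (s * b)) = s * c.
  by rewrite /f /x1_coord /= mxE /c; ring.
have {}c0 : c = 0.
  apply/eqP; rewrite eq_le c0 andbT leNgt; apply/negP => c_gt0.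
  have := bound ((M + 2) / c * a, const_mx ((M + 2) / c * b)).
  rewrite fs divfK ?gt_eqF //; have := ler_norm (M + 2); lra.
by move/eqP: c0; rewrite paddr_eq0 ?sqr_ge0 // !sqrf_eq0 => /andP[/eqP -> /eqP ->].
Qed.

(** The determinant of the images of [g] and [h] in R^2; by [commutator_lead] it is also the
    x_2-coordinate of their commutator. *)
Definition omega g h : R := g.1 * x1_coord h - h.1 * x1_coord g.

(** Otherwise each form [omega g] with [g] in [Gamma] kills [Gamma] and so has zero coefficients.
    Then [x1_coord] kills [Gamma] too, which [lattice_not_in_kernel] forbids. *)
Lemma lattice_omega_neq0 :
  exists g h, [/\ g \in Gamma, h \in Gamma & omega g h != 0].
Proof.
apply: contrapT => /forallNP no.
have om g h : g \in Gamma -> h \in Gamma -> omega g h = 0.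
  move=> gG hG; apply/eqP; apply/negPn/negP => gh.
  by apply: (no g); exists h.
have [|_ /eqP] := @lattice_not_in_kernel 0 1; last by rewrite oner_eq0.
move=> g gG; rewrite mul0r mul1r add0r.
have [|/eqP + _] := @lattice_not_in_kernel (- x1_coord g) g.1; last first.
  by rewrite oppr_eq0 => /eqP.
by move=> h hG; rewrite -(om _ _ gG hG) /omega; ring.
Qed.

(** The identity is isolated in [Gamma], and each of its neighbourhoods contains the [(0, v)] whose
    only nonzero coordinate is the last one, if that is small. *)
Lemma lattice_last_discrete : exists2 eps : R, 0 < eps &
  forall v i, i = n.-1 :> nat -> (0, v) \in Gamma -> vanishes_below i v ->
  `|v i 0| < eps -> v i 0 = 0.
Proof.
have [iso _] := Gamma_lattice.
have : isolated [set x | x \in Gamma] 1%g by rewrite iso /= gpred1.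
case=> _ [V [[A B] [A0 [P P0 PB]] AB] VG].
have /nbhs_ballP [eps eps0 epsP] := P0 last 0.
exists eps => // v l l_last vG v_low v_lt.
have {}l_last : l = last by apply: val_inj.
rewrite {}l_last in v_low v_lt *.
have : (V `&` [set x | x \in Gamma])%classic (0, v).
  split=> //; apply: AB; split; first exact: nbhs_singleton A0.
  apply: PB => i j; rewrite (ord1 j).
  have [->|i_last] := eqVneq i last.
    by apply: epsP; rewrite /ball /= mxE sub0r normrN.
  rewrite v_low; last by move: i_last; rewrite -val_eqE /=; have := ltn_ord i; lia.
  by have := nbhs_singleton (P0 i 0); rewrite mxE.
by rewrite VG => -[->]; rewrite mxE.
Qed.

Lemma lattice_unip_iter m g v : g \in Gamma -> (0, v) \in Gamma ->
  (0, iter m (mulmx (unip g.1)) v) \in Gamma.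
Proof.
move=> gG vG; elim: m => //= m IH; set w := iter _ _ _.
pose z : filiform R n := (0, w).
have -> : (0, unip g.1 *m w) = (g * z * g^-1 * z^-1)%g.
  apply: (mulIg z); rewrite mulgVK filiform_conj.
  by rewrite filiform_mul0 addrC.
apply: gpredM; rewrite ?gpredV //.
by apply: gpredM; rewrite ?gpredV //; apply: gpredM.
Qed.

(** Applying [unip g.1] as many times as the exponent says carries the leading coordinate to the
    last position, where [lattice_last_discrete] applies. *)
Lemma lattice_lead_discrete : exists2 eps : R, 0 < eps &
  forall g v i, g \in Gamma -> (0, v) \in Gamma -> vanishes_below i v ->
  `|g.1 ^+ (n.-1 - i) * v i 0| < eps -> g.1 ^+ (n.-1 - i) * v i 0 = 0.
Proof.
have [eps eps0 epsP] := lattice_last_discrete.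
exists eps => // g v i gG vG v_low.
have last_i : last = (i + (n.-1 - i))%N :> nat by have := ltn_ord i; rewrite /=; lia.
rewrite -(unip_iter_lead _ last_i v_low) => lt_eps.
apply: epsP lt_eps; rewrite ?lattice_unip_iter //.
by rewrite [X in vanishes_below X]last_i; apply: unip_iter_low.
Qed.

Definition line_form (a b : R) g : R := a * g.1 + b * x1_coord g.

Lemma line_formM a b : {morph line_form a b : g h / (g * h)%g >-> g + h}.
Proof. by move=> g h; rewrite /line_form x1_coordM /=; ring. Qed.

(** For [(a, b)] nonzero, the preimage of a line of R^2: [(1, 0)] gives H_n and
    [(- x1_coord g, g.1)] the kernel of [omega g]. *)
Definition line_subgroup a b : {pred filiform R n} :=
  fun g => line_form a b g == 0.

Lemma omega_line_form g h : omega g h = line_form (- x1_coord g) g.1 h.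
Proof. by rewrite /omega /line_form; ring. Qed.

Lemma commutator_low g h :
  vanishes_below 1 (unip g.1 *m h.2 - unip h.1 *m g.2).
Proof. by apply: vanishes_belowB; exact: unip_low. Qed.

Lemma commutator_lead g h i : i = 1 :> nat ->
  (unip g.1 *m h.2 - unip h.1 *m g.2) i 0 = omega g h.
Proof. by move=> i1; rewrite mxE [X in _ + X]mxE !(@unip_lead _ _ i0). Qed.

End FiliformLattice.

(** * Preimages of lines as maximal abelian normal subgroups *)

Section LineSubgroup.
Variables (R : realType) (n : nat) (n_gt0 : (0 < n)%N) (a b : R).
Local Notation H := (line_subgroup n_gt0 a b).

Fact line_subgroup_mul : mulg_closed H.
Proof.
move=> g h; rewrite !unfold_in => /eqP g0 /eqP h0.
by rewrite line_formM g0 h0 addr0.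
Qed.

Fact line_subgroup_1 : 1%g \in H.
Proof. by rewrite unfold_in (additive1 (line_formM _ _ _)). Qed.

Fact line_subgroup_inv : invg_closed H.
Proof.
by move=> g; rewrite !unfold_in (additiveV (line_formM _ _ _)) oppr_eq0.
Qed.

HB.instance Definition _ := isMulClosed.Build (filiform R n) H line_subgroup_mul.
HB.instance Definition _ := isMul1Closed.Build (filiform R n) H line_subgroup_1.
HB.instance Definition _ := isInvClosed.Build (filiform R n) H line_subgroup_inv.

Lemma line_subgroup_maximal : (1 < n)%N ->
  {in H &, forall x y, commute x y} -> maximal_abelian_normal H.
Proof.
move=> n_gt1 Habel; split; first split=> // x y.
  rewrite !unfold_in => /eqP x0.
  by rewrite conjgE !line_formM (additiveV (line_formM _ _ _)) x0 add0r addNr.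
move=> K [Kabel _] HK g gK.
(* This element of [H] satisfies [omega y g = - line_form a b g], so whatever commutes with it lies
   in [H]. *)
pose y : filiform R n := (- b, const_mx a).
have yH : y \in H by rewrite unfold_in /line_form /x1_coord mxE /=; apply/eqP; ring.
have : (y * g * (g * y)^-1)%g = 1%g.
  by rewrite (Kabel _ _ (HK _ yH) gK) mulgV.
rewrite filiform_commutator => /(congr1 snd) yg.
have := commutator_lead n_gt0 y g (erefl : Ordinal n_gt1 = 1 :> nat).
rewrite [unip _ _ *m _ - _]yg mxE /omega [x1_coord _ y]mxE => {}yg.
by rewrite unfold_in /line_form; apply/eqP; rewrite -[RHS]oppr0 yg /=; ring.
Qed.

End LineSubgroup.

Lemma abelian_normal_ker (G : groupType) (H K : groupClosed G) :
  abelian_normal H -> abelian_normal (ker_proj_incl H K).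
Proof.
move=> [Habel Hnorm]; split=> [x y|x y]; rewrite !ker_proj_inclE.
  by move=> xH yH; apply: val_inj; rewrite !valM; exact: Habel.
by move=> xH; rewrite gmulfJ; apply: Hnorm.
Qed.

(** * Splitting along H_n for [n >= 3] *)

Section Splitting.
Variables (R : realType) (n : nat) (n_gt0 : (0 < n)%N).
Variable Gamma : groupClosed (filiform R n).
Hypothesis Gamma_lattice : is_lattice Gamma.
Local Notation x1_coord := (x1_coord n_gt0).
Local Notation omega := (omega n_gt0).
Local Notation line_form := (line_form n_gt0).
Local Notation line_subgroup := (line_subgroup n_gt0).
Let i0 := Ordinal n_gt0.

Lemma lattice_commutator (g h : filiform R n) : g \in Gamma -> h \in Gamma ->
  (0, unip n g.1 *m h.2 - unip n h.1 *m g.2) \in Gamma.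
Proof.
move=> gG hG; rewrite -filiform_commutator.
by apply: gpredM; rewrite ?gpredV; apply: gpredM.
Qed.

Lemma fst_line_form (g : filiform R n) : line_form 1 0 g = g.1.
Proof. by rewrite /line_form mul1r mul0r addr0. Qed.

Lemma line_subgroup_Hn : line_subgroup 1 0 =i Hn R n.
Proof. by move=> g; rewrite !unfold_in fst_line_form. Qed.

Lemma Hn_abelian :
  {in line_subgroup 1 0 &, forall x y : filiform R n, commute x y}.
Proof.
move=> [a v] [b w]; rewrite !line_subgroup_Hn !unfold_in => /eqP /= -> /eqP /= ->.
by rewrite /commute !filiform_mul0 addrC.
Qed.

Lemma lattice_fst_discrete : (2 < n)%N -> exists2 eps : R, 0 < eps &
  forall g, g \in Gamma -> `|g.1| < eps -> g.1 = 0.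
Proof.
move=> n_gt2; have n_gt1 := ltnW n_gt2.
have [eps eps0 epsP] := lattice_lead_discrete n_gt0 Gamma_lattice.
have [g [h [gG hG gh]]] := lattice_omega_neq0 n_gt0 Gamma_lattice.
pose i1 := Ordinal n_gt1; pose c := unip n g.1 *m h.2 - unip n h.1 *m g.2.
have cG : (0, c) \in Gamma by exact: lattice_commutator.
have c1 : c i1 0 = omega g h by exact: commutator_lead.
have w0 : 0 < `|omega g h| by rewrite normr_gt0.
(* The bound 1 gives [|x.1| ^ (n - 2) <= |x.1|], where [n > 2] makes the exponent positive; the
   other bound then brings the product with [omega g h] below [eps]. *)
exists (Num.min 1 (eps / `|omega g h|)); first by rewrite lt_min ltr01 divr_gt0.
move=> x xG; rewrite lt_min ltr_pdivlMr // => /andP[x1 x_lt].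
have /eqP : x.1 ^+ (n.-1 - i1) * c i1 0 = 0.
  apply: epsP => //; first exact: commutator_low.
  apply: le_lt_trans x_lt; rewrite normrM c1 normrX ler_pM2r //.
  rewrite -[leRHS]expr1; apply: ler_wiXn2l => //; first exact: ltW.
  by rewrite /=; lia.
by rewrite mulf_eq0 c1 (negbTE gh) orbF expf_eq0 => /andP[_ /eqP].
Qed.

Lemma splitting_ge3 : (2 < n)%N ->
  unipotent_splitting (ker_proj_incl (line_subgroup 1 0) Gamma) n.
Proof.
move=> n_gt2; set L := ker_proj_incl _ _.
have [g [h [gG hG gh]]] := lattice_omega_neq0 n_gt0 Gamma_lattice.
have [eps eps0 epsP] := lattice_fst_discrete n_gt2.
pose p (x : subgroup Gamma) : R := (val x).1.
have pM : {morph p : x y / (x * y)%g >-> x + y} by move=> x y; rewrite /p valM.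
have LE x : (x \in L) = (p x == 0).
  by rewrite ker_proj_inclE line_subgroup_Hn unfold_in.
have [||t t0 tP] := discrete_image_cyclic pM eps0.
- by move=> x; apply: epsP; exact: valP.
- apply: contrapT => /forallNP no.
  have p0 x : x \in Gamma -> x.1 = 0.
    move=> xG; have := no (in_subgroup xG).
    by rewrite /p in_subgroupK => /negP/negPn/eqP.
  by move/eqP: gh; apply; rewrite /omega (p0 g) // (p0 h) // !mul0r subrr.
have L0 (x : subgroup L) : val (val x) = (0, (val (val x)).2).
  have := valP x; rewrite LE => /eqP; rewrite /p.
  by case: (val (val x)) => a v /= ->.
pose pi (x : subgroup L) : 'cV[R]_n := (val (val x)).2.
have in_L v : (0, v) \in Gamma -> exists x : subgroup L, pi x = v.
  move=> vG; have vL : in_subgroup vG \in L by rewrite LE /p.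
  by exists (in_subgroup vL).
have xG (x : subgroup L) : (0, pi x) \in Gamma.
  by rewrite -L0; exact: valP.
apply: (@filtered_extension R n _ L p t pi) => //.
- by move=> x y; rewrite /pi !valM L0 [val (val y)]L0 filiform_mul0.
- by move=> x x0; do 2!apply: val_inj; rewrite L0 -/(pi x) x0.
- move=> k x y yE x_low.
  have -> : pi y = pi x + unip n (p t) *m pi x.
    by rewrite /pi yE !valM gmulfV L0 filiform_conj.
  by rewrite addrC addKr; exact: unip_low.
- move=> k; have [d d0 dP] := lattice_lead_discrete n_gt0 Gamma_lattice.
  (* With [t] fixed, discreteness of the coordinates multiplied by this nonzero constant gives
     discreteness of the coordinates themselves. *)
  have tk : p t ^+ (n.-1 - k) != 0 by rewrite expf_neq0.
  exists (d / `|p t ^+ (n.-1 - k)|) => [|x x_low].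
    by rewrite divr_gt0 ?normr_gt0.
  rewrite ltr_pdivlMr ?normr_gt0 // mulrC -normrM => /dP.
  move=> /(_ (valP t) (xG x) x_low) /eqP.
  by rewrite mulf_eq0 (negbTE tk) => /eqP.
- move=> k; have [m mP] := choice tP.
  pose g' := in_subgroup gG; pose h' := in_subgroup hG.
  (* The exponents cancel the first components, so [l] lies in [L], while its x_1-coordinate is
     [- omega g h / p t]. Applying [unip (p t)] to it [k] times leads in position [k]. *)
  pose l := (expgz g' (m h') * (expgz h' (m g'))^-1)%g.
  have pl : p l = 0.
    rewrite pM (additiveV pM) !(additive_expgz pM) -[p g' *~ _]mulrzl.
    by rewrite -[p h' *~ _]mulrzl (mP g') (mP h'); ring.
  have ql : x1_coord (val l) * p t = - omega g h.
    pose q (x : subgroup Gamma) := x1_coord (val x).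
    have qM : {morph q : x y / (x * y)%g >-> x + y}.
      by move=> x y; rewrite /q valM x1_coordM.
    rewrite -/(q l) qM (additiveV qM) !(additive_expgz qM) -[q g' *~ _]mulrzl.
    rewrite -[q h' *~ _]mulrzl /omega.
    by rewrite -[g.1]/(p g') -[h.1]/(p h') (mP g') (mP h') /q; ring.
  have lE : val l = (0, (val l).2).
    by move: pl; rewrite /p; case: (val l) => a v /= ->.
  have lG : (0, (val l).2) \in Gamma by rewrite -lE; exact: valP.
  have := lattice_unip_iter k (valP t) lG.
  move=> /in_L [x xE]; exists x; rewrite xE.
    by rewrite -[X in vanishes_below X]add0n; exact: unip_iter_low.
  rewrite (@unip_iter_lead _ _ _ _ _ i0) // mulf_neq0 ?expf_neq0 //.
  apply: contraNneq gh => l0.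
  by rewrite -[omega g h]opprK -ql /x1_coord l0 mul0r oppr0.
Qed.

End Splitting.

(** * The Heisenberg group, [n = 2] *)

Section Heisenberg.
Variables (R : realType) (lt02 : (0 < 2)%N).
Local Notation F2 := (filiform R 2).
Let i0 : 'I_2 := Ordinal lt02.
Let i1 : 'I_2 := Ordinal (isT : (1 < 2)%N).
Local Notation x1_coord := (@x1_coord R 2 lt02).
Local Notation omega := (@omega R 2 lt02).
Local Notation line_form := (@line_form R 2 lt02).
Implicit Types g h x y : F2.

Lemma omegaM g : {morph omega g : x y / (x * y)%g >-> x + y}.
Proof. by move=> x y; rewrite !omega_line_form line_formM. Qed.

(** The Pluecker relation between 2 x 2 minors; it makes [omega] vanish on pairs from the kernel of
    [omega g]. *)
Lemma omega_plucker g h x y :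
  omega g h * omega x y = omega g x * omega h y - omega g y * omega h x.
Proof. by rewrite /omega; ring. Qed.

Lemma ord2 (i : 'I_2) : i = i0 \/ i = i1.
Proof. by case: i => [[|[|//]] ?]; [left|right]; apply: val_inj. Qed.

Lemma commute_omega x y : omega x y = 0 -> commute x y.
Proof.
move=> xy; apply: divg1_eq; rewrite filiform_commutator; congr pair.
apply/colP => i; rewrite [RHS]mxE; case: (ord2 i) => ->.
  by rewrite commutator_low.
by rewrite (commutator_lead lt02).
Qed.

(** Cramer's rule: the images of [g] and [h] form a basis of R^2. *)
Lemma omega_eq0 g h x : omega g h != 0 -> omega g x = 0 -> omega h x = 0 ->
  x.1 = 0 /\ x1_coord x = 0.
Proof.
move=> gh gx hx; split; apply: (mulfI gh); rewrite mulr0.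
  transitivity (h.1 * omega g x - g.1 * omega h x); last by rewrite gx hx; ring.
  by rewrite /omega; ring.
transitivity (x1_coord h * omega g x - x1_coord g * omega h x).
  by rewrite /omega; ring.
by rewrite gx hx; ring.
Qed.

(* The x_2-coordinate in exponential coordinates of the first kind, which is
   additive on commuting pairs. *)
Definition x2_coord x : R := x.2 i1 0 - x.1 * x1_coord x / 2.

Lemma x2_coordM x y : omega x y = 0 ->
  x2_coord (x * y)%g = x2_coord x + x2_coord y.
Proof.
rewrite /x2_coord x1_coordM filiform_mulE /= exp_unip => /eqP.
rewrite subr_eq0 => /eqP xy.
have E : (unip 2 x.1 *m y.2) i1 0 = x.1 * x1_coord y.
  exact: (@unip_lead _ _ _ _ i0).
have -> : (x.2 + (y.2 + unip 2 x.1 *m y.2)) i1 0 =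
  x.2 i1 0 + (y.2 i1 0 + x.1 * x1_coord y) by rewrite -E !mxE.
(* Since [omega x y = 0], both cross terms equal [x.1 * x1_coord y]; half their sum cancels the
   extra term of the product. *)
have -> : (x.1 + y.1) * (x1_coord x + x1_coord y) =
  x.1 * x1_coord x + y.1 * x1_coord y + x.1 * x1_coord y + x.1 * x1_coord y.
  by rewrite {2}xy; ring.
by field.
Qed.

(** The projection of [Gamma] to F_2 / H_2 may be dense. The values of [omega] on [Gamma] are
    discrete, being x_2-coordinates of commutators, so [omega g] replaces that projection. *)
Lemma splitting_2 (Gamma : groupClosed F2) : is_lattice Gamma ->
  exists a b, {in line_subgroup lt02 a b &, forall x y : F2, commute x y} /\
    unipotent_splitting (ker_proj_incl (line_subgroup lt02 a b) Gamma) 2.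
Proof.
move=> Gamma_lattice.
have [g [h [gG hG gh]]] := lattice_omega_neq0 lt02 Gamma_lattice.
have [eps eps0 epsP] := lattice_last_discrete lt02 Gamma_lattice.
have omega_disc x y : x \in Gamma -> y \in Gamma ->
    `|omega x y| < eps -> omega x y = 0.
  move=> xG yG; have cE := commutator_lead lt02 x y (erefl : i1 = 1 :> nat).
  rewrite -cE; apply: epsP => //; first exact: lattice_commutator.
  exact: commutator_low.
exists (- x1_coord g), g.1; set H := line_subgroup _ _ _.
have HE x : (x \in H) = (omega g x == 0) by rewrite omega_line_form.
have Homega x y : x \in H -> y \in H -> omega x y = 0.
  rewrite !HE => /eqP gx /eqP gy; apply: (mulfI gh).
  by rewrite omega_plucker gx gy !mul0r subrr mulr0.
split; first by move=> x y xH yH; apply: commute_omega; exact: Homega.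
set L := ker_proj_incl _ _.
pose p (x : subgroup Gamma) : R := omega g (val x).
have pM : {morph p : x y / (x * y)%g >-> x + y}.
  by move=> x y; rewrite /p valM omegaM.
have LE (x : subgroup Gamma) : (x \in L) = (p x == 0) by rewrite ker_proj_inclE HE.
have [||t t0 tP] := discrete_image_cyclic pM eps0.
- by move=> x; apply: omega_disc => //; exact: valP.
- by exists (in_subgroup hG).
have LH (x : subgroup L) : val (val x) \in H.
  by have := valP x; rewrite LE HE.
have Lg (x : subgroup L) : omega g (val (val x)) = 0.
  by have := LH x; rewrite HE => /eqP.
(* As [omega g t] is nonzero, [omega t] detects the image in R^2 of an element of [H]; [x2_coord] is
   additive on [H], where any two elements commute. *)
pose pi (x : subgroup L) : 'cV[R]_2 :=
  \col_i if i == i0 then omega (val t) (val (val x)) else x2_coord (val (val x)).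
have pi0 (x : subgroup L) : pi x i0 0 = omega (val t) (val (val x)).
  by rewrite mxE eqxx.
have pi1 (x : subgroup L) : pi x i1 0 = x2_coord (val (val x)) by rewrite mxE.
have in_L x : x \in Gamma -> omega g x = 0 -> exists y : subgroup L,
    pi y i0 0 = omega (val t) x /\ pi y i1 0 = x2_coord x.
  move=> xG gx; have xL : in_subgroup xG \in L by rewrite LE /p gx.
  by exists (in_subgroup xL); rewrite pi0 pi1.
have low1 (x : subgroup L) : vanishes_below 1 (pi x) ->
    val (val x) = (0, (val (val x)).2) /\ vanishes_below 1 (val (val x)).2.
  move=> x_low; have [|x1 x2] := omega_eq0 t0 (Lg x); first by rewrite -pi0 x_low.
  split; first by case: (val (val x)) x1 => a v /= ->.
  by move=> i; rewrite ltnS leqn0 => /eqP i_0; have -> : i = i0 by apply: val_inj.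
apply: (@filtered_extension R 2 _ L p t pi) => //.
- move=> x y; apply/colP => i; rewrite [RHS]mxE; case: (ord2 i) => ->.
    by rewrite !pi0 !valM omegaM.
  by rewrite !pi1 !valM x2_coordM // Homega.
- move=> x x0; have [|xE x_low] := low1 x; first by move=> i _; rewrite x0 mxE.
  have x1 : x2_coord (val (val x)) = 0 by rewrite -pi1 x0 mxE.
  do 2!apply: val_inj; rewrite xE; congr pair.
  apply/colP => i; rewrite [RHS]mxE; case: (ord2 i) => ->; first exact: x_low.
  by move: x1; rewrite /x2_coord xE /= mul0r mul0r subr0.
- move=> k x y yE x_low.
  have yE' : val (val y) = (val t * val (val x) * (val t)^-1)%g.
    by rewrite yE !valM gmulfV.
  (* At position 0, [omega t] is invariant under conjugation. At position 1, [omega t x = 0], so [x]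
     commutes with [t]. *)
  case: (ord2 k) x_low => -> x_low.
    move=> i; rewrite ltnS leqn0 => /eqP i_0.
    have -> : i = i0 by apply: val_inj.
    rewrite mxE [X in _ + X]mxE !pi0 yE' !omegaM (additiveV (omegaM _)).
    by ring.
  have -> : y = x; last by rewrite subrr => i _; rewrite mxE.
  have tx : omega (val t) (val (val x)) = 0 by rewrite -pi0 x_low.
  by do 2!apply: val_inj; rewrite yE' (commute_omega tx) mulgK.
- move=> k; exists eps => // x x_low; case: (ord2 k) x_low => -> x_low.
    by rewrite pi0; apply: omega_disc; exact: valP.
  have [xE v_low] := low1 x x_low.
  have -> : pi x i1 0 = (val (val x)).2 i1 0.
    by rewrite pi1 /x2_coord {2}xE /= mul0r mul0r subr0.
  by apply: epsP => //; rewrite -xE; exact: valP.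
(* The witnesses are [g] itself, as [omega t g = - omega g t], and the commutator of [g] and [h],
   whose [x2_coord] is [omega g h]. *)
- move=> k; case: (ord2 k) => ->.
    have [|x [x0 _]] := in_L g gG; first by rewrite /omega subrr.
    exists x => //; rewrite x0; apply: contraNneq t0 => tg.
    by rewrite /p -oppr_eq0 -tg /omega; apply/eqP; ring.
  have cG := lattice_commutator gG hG.
  set c : F2 := (_, _) in cG.
  have [c1 c2] : c.1 = 0 /\ x1_coord c = 0.
    by split=> //; rewrite /x1_coord commutator_low.
  have c0 x : omega x c = 0 by rewrite /omega c1 c2 mulr0 mul0r subrr.
  have [//|x [x0 x1]] := in_L c cG.
  exists x.
    move=> i /=; rewrite ltnS leqn0 => /eqP i_0.
    by have -> : i = i0 by [apply: val_inj]; rewrite x0 c0.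
  by rewrite x1 /x2_coord c1 !mul0r subr0 (commutator_lead lt02).
Qed.

End Heisenberg.

Theorem theorem3 (R : realType) (n : nat) (n_ge2 : (2 <= n)%N)
    (Gamma : groupClosed (filiform R n)) (Gamma_lattice : is_lattice Gamma) :
  exists H : groupClosed (filiform R n),
    [/\ maximal_abelian_normal H,
        (3 <= n)%N -> H =i Hn R n,
        abelian_normal (ker_proj_incl H Gamma) &
        exists (phi : Zaction (subgroup (ker_proj_incl H Gamma)))
               (e : 'I_n -> subgroup (ker_proj_incl H Gamma))
               (a : 'M[int]_n),
          let g1 : 'M[int]_n :=
            1%:M + \sum_(k < n) \sum_(l < n | (l < k)%N) a k l *: delta_mx k l in
          [/\ is_Zbasis e, unipotent_mx g1, has_matrix e (phi 1) g1 &
              isomorphic (subgroup Gamma) (sdprodZ phi)]].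
Proof.
have n_gt0 := ltnW n_ge2.
have [n_gt2|n_le2] := ltnP 2 n.
  have Hmax := line_subgroup_maximal n_ge2 (@Hn_abelian R n n_gt0).
  eexists; split; first exact: Hmax.
  - by move=> _; exact: line_subgroup_Hn.
  - by apply: abelian_normal_ker; case: Hmax.
  exact: splitting_ge3.
have n2 : n = 2 by apply/eqP; rewrite eqn_leq n_le2.
subst n; have [a [b [Habel split2]]] := splitting_2 n_gt0 Gamma_lattice.
have Hmax := line_subgroup_maximal n_ge2 Habel.
eexists; split; first exact: Hmax; last exact: split2; first by [].
by apply: abelian_normal_ker; case: Hmax.
Qed.
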